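(* Let $\Sigma$ be a compact topological group acting measurably from the left on a measurable space $\mathcal X$, let $\pi$ be the left Haar probability measure of $\Sigma$, and let $\mathcal P$ be the set of all $\Sigma$-invariant probability measures on $\mathcal X$. The set of all e-variables for $\mathcal P$ consists precisely of those $[0,\infty]$-valued measurable functions on $\mathcal X$ that are pointwise dominated by an e-variable of the form $$1+f-f_\pi$$ for some $[-1,\infty]$-valued measurable function $f$ on $\mathcal X$ such that $f_\pi\le 0$. Moreover, every function of this form is an exact e-variable, meaning that $\int_{\mathcal X}(1+f-f_\pi)\,d\mu=1$ for all $\mu\in\mathcal P$.
   Context: A left action of $\Sigma$ on $\mathcal X$ assigns to each $\sigma\in\Sigma$ a map $x\mapsto\sigma x$ on $\mathcal X$, with the identity element inducing the identity map and $(\sigma_1\sigma_2)x=\sigma_1(\sigma_2x)$. The action is measurable if $(\sigma,x)\mapsto\sigma x$ is jointly measurable from $\Sigma\times\mathcal X$ to $\mathcal X$, where $\Sigma$ carries its Borel $\sigma$-algebra. For a measurable function $f$ bounded below (possibly taking the value $+\infty$), its orbit average is $f_\pi(x)=\int_\Sigma f(\sigma x)\,\pi(d\sigma)$. For $\sigma\in\Sigma$, $\sigma_*\mu$ denotes the pushforward of $\mu$ under $x\mapsto\sigma x$, and $\mathcal P=\{\mu \text{ probability measure on }\mathcal X:\mu=\sigma_*\mu\text{ for all }\sigma\in\Sigma\}$. An e-variable for $\mathcal P$ is a measurable $h:\mathcal X\to[0,\infty]$ with $\int_{\mathcal X}h\,d\mu\le 1$ for all $\mu\in\mathcal P$. 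*)

(* Defs.v *)
From HB Require Import structures.
From mathcomp Require Import all_boot all_order all_algebra.
From mathcomp Require Import all_classical all_reals all_analysis measurable_realfun.

Set Implicit Arguments.
Unset Strict Implicit.
Unset Printing Implicit Defensive.

Import Order.TTheory GRing.Theory Num.Theory.
Import numFieldNormedType.Exports.

Local Open Scope classical_set_scope.
Local Open Scope ereal_scope.

HB.mixin Record isTopologicalGroup G & Topological G & Group G := {
  mulg_continuous : continuous (fun x : G * G => (x.1 * x.2)%g) ;
  invg_continuous : continuous (fun x : G => (x^-1)%g)
}.

(* The distinguished point plays no role: the library only builds generated
   sigma-algebras over pointed types. *)
#[short(type="topologicalGroupType")]
HB.structure Definition TopologicalGroup :=
  {G of Pointed G & Topological G & Group G & isTopologicalGroup G}.

Notation borel G := (g_sigma_algebraType (@open G)).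

(* No separation axiom is assumed on [G]. Compact sets are Borel when [G] is
   Hausdorff; otherwise inner regularity has to ask for it. *)
Definition left_haar (G : topologicalGroupType) (R : realType)
    (pi : probability (borel G) R) : Prop :=
  [/\ forall (s : G) (A : set (borel G)), measurable A ->
        pi [set (s * t)%g | t in (A : set G)] = pi A,
      forall A : set (borel G), measurable A ->
        pi A = ereal_inf [set pi U | U in [set U : set G | open U /\ A `<=` U]]
    & forall U : set G, open U ->
        pi U = ereal_sup [set pi K | K in
          [set K : set G |
            [/\ compact K, measurable (K : set (borel G)) & K `<=` U]]]].

Definition left_action (G : groupType) (X : Type) (act : G -> X -> X) : Prop :=
  (forall x, act 1%g x = x) /\
  (forall s t x, act (s * t)%g x = act s (act t x)).

Definition measurable_action (G : topologicalGroupType) d (X : measurableType d)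
    (act : G -> X -> X) : Prop :=
  measurable_fun [set: borel G * X] (fun p : borel G * X => act p.1 p.2).

Definition orbit_average (G : topologicalGroupType) d (X : measurableType d)
    (R : realType) (pi : probability (borel G) R) (act : G -> X -> X)
    (f : X -> \bar R) (x : X) : \bar R :=
  \int[pi]_(s in [set: borel G]) f (act s x).

(* Measures are total set functions in the library, with meaningful values on
   measurable sets only, hence the equality of measures is stated on those. *)
Definition invariant_probability (G : topologicalGroupType) d
    (X : measurableType d) (R : realType) (act : G -> X -> X) :
    set (probability X R) :=
  [set mu | forall (s : G) (A : set X), measurable A ->
     mu A = pushforward mu (act s) A].

Definition e_variable d (X : measurableType d) (R : realType)
    (P : set (probability X R)) (h : X -> \bar R) : Prop :=
  [/\ measurable_fun [set: X] h,
      forall x, 0 <= h x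
    & forall mu, P mu -> \int[mu]_(x in [set: X]) h x <= 1].

Definition exact_e_variable d (X : measurableType d) (R : realType)
    (P : set (probability X R)) (h : X -> \bar R) : Prop :=
  e_variable P h /\ forall mu, P mu -> \int[mu]_(x in [set: X]) h x = 1.

(* Main.v *)
(* The law of [s x] under [s ~ pi] is an invariant probability by left invariance
   of [pi], so testing an e-variable [h] against it gives [h_pi x <= 1]; hence
   [f := h - 1] satisfies [f_pi <= 0] and [h <= h - f_pi = 1 + f - f_pi].
   Conversely, Tonelli and invariance give [int (1 + f) = int (1 + f_pi)] for an
   invariant [mu], and adding [int (- f_pi)] to both sides gives exactness without
   any subtraction of possibly infinite integrals. *)
Require Import Defs.
From HB Require Import structures.
From mathcomp Require Import all_boot all_order all_algebra.
From mathcomp Require Import all_classical all_reals all_analysis measurable_realfun.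

Set Implicit Arguments.
Unset Strict Implicit.
Unset Printing Implicit Defensive.

Import Order.TTheory GRing.Theory Num.Theory.
Import numFieldNormedType.Exports.

Local Open Scope classical_set_scope.
Local Open Scope ereal_scope.

Lemma adde1_ge0 (R : realType) (x : \bar R) : (0 <= 1 + x) = (-1 <= x).
Proof. by rewrite addeC -leeBlDr// sub0e. Qed.

Lemma integral_cst_probability d (T : measurableType d) (R : realType)
    (mu : probability T R) (c : \bar R) : \int[mu]_x cst c x = c.
Proof. by rewrite integral_cst// [X in _ * X]probability_setT mule1. Qed.

(** The integral of [f] may be [+oo], but [f^\-] is bounded by 1 and so has a finite integral.
    Adding that integral to both sides leaves only integrals of nonnegative functions, where
    additivity is unconditional; it is then cancelled. *)
Lemma integral_addl1 d (T : measurableType d) (R : realType)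
    (mu : probability T R) (f : T -> \bar R) :
  measurable_fun [set: T] f -> (forall x, -1 <= f x) ->
  \int[mu]_x (1 + f x) = 1 + \int[mu]_x f x.
Proof.
move=> mf f_ge.
have mfp := measurable_funepos mf; have mfn := measurable_funeneg mf.
have fnE x : f^\- x <= 1.
  by rewrite funenegE ge_max lee01 leeNl f_ge.
have fn_fin : \int[mu]_x f^\- x \is a fin_num.
  rewrite ge0_fin_numE ?integral_ge0//.
  apply: (@le_lt_trans _ _ (\int[mu]_x (cst 1 x))); last first.
    by rewrite integral_cst_probability ltry.
  by apply: ge0_le_integral => //= x _; exact: fnE.
have f1_ge0 x : 0 <= 1 + f x by rewrite adde1_ge0.
have eqD : \int[mu]_x (1 + f x) + \int[mu]_x f^\- x = 1 + \int[mu]_x f^\+ x.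
  rewrite -ge0_integralD//; last exact: emeasurable_funD.
  transitivity (\int[mu]_x (cst 1 x + f^\+ x)).
    apply: eq_integral => x _ /=.
    have fx_fin : f^\- x \is a fin_num.
      by rewrite ge0_fin_numE// (le_lt_trans (fnE x))// ltry.
    have -> : f x = f^\+ x - f^\- x by rewrite [in LHS](funeposneg f).
    by rewrite -addeA subeK.
  by rewrite ge0_integralD// integral_cst_probability.
by rewrite [X in 1 + X]integralE addeA -eqD addeK.
Qed.

Section OrbitAverage.
Context {R : realType} {G : topologicalGroupType} {d : measure_display}
  {X : measurableType d} {act : G -> X -> X} { pi : probability (borel G) R}.
Hypotheses (act_left : left_action act) (act_measurable : measurable_action act).

Lemma measurable_act (s : G) : measurable_fun [set: X] (act s).
Proof.
exact: (measurableT_comp act_measurable (pair1_measurable (s : borel G))).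
Qed.

Lemma measurable_orbit_map (x : X) :
  measurable_fun [set: borel G] (fun s : borel G => act s x).
Proof. exact: (measurableT_comp act_measurable (pair2_measurable x)). Qed.

(** The times [t] at which [act s (act t x)] lies in [A] form the left translate by [s^-1] of those
    at which [act t x] does, and [pi] does not see left translations. *)
Lemma orbit_law_invariant (x : X)
    (orbit_map : {mfun borel G >-> X}) (nu : probability X R) :
  (forall (s : G) (A : set (borel G)), measurable A ->
     pi [set (s * t)%g | t in (A : set G)] = pi A) ->
  (forall s, orbit_map s = act s x) ->
  (forall A, nu A = distribution pi orbit_map A) ->
  invariant_probability act nu.
Proof.
move=> pi_inv orbitE nuE s A mA.
rewrite /pushforward !nuE /distribution /pushforward.
rewrite -[LHS](pi_inv s^-1%g); last first.
  by rewrite -[X in measurable X]setTI; exact: measurable_funPT.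
congr (pi _); apply/seteqP; split => t /=.
  by move=> [u + <-]; rewrite !orbitE -(proj2 act_left) mulVKg.
move=> At; exists (s * t)%g; last by rewrite mulKg.
by rewrite orbitE (proj2 act_left) -orbitE.
Qed.

Lemma orbit_average_le1 (h : X -> \bar R) (x : X) :
  (forall (s : G) (A : set (borel G)), measurable A ->
     pi [set (s * t)%g | t in (A : set G)] = pi A) ->
  e_variable (invariant_probability (R := R) act) h ->
  orbit_average pi act h x <= 1.
Proof.
move=> pi_inv [mh h_ge0 h_le1].
pose orbit_map := mfun_Sub (mem_set (measurable_orbit_map x)).
pose nu : probability X R := distribution pi orbit_map.
have := h_le1 nu (@orbit_law_invariant x orbit_map nu pi_inv
  (fun=> erefl) (fun=> erefl)).
by rewrite ge0_integral_distribution.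
Qed.

(** The point comes first in the pair so that integrating out the second coordinate, as in Tonelli's
    theorem, yields the orbit average as a function of the point. *)
Lemma measurable_act_comp (g : X -> \bar R) : measurable_fun [set: X] g ->
  measurable_fun [set: X * borel G] (fun p : X * borel G => g (act p.2 p.1)).
Proof.
move=> mg; apply: (measurableT_comp mg).
have mswap : measurable_fun [set: X * borel G]
    (fun p : X * borel G => (p.2, p.1)).
  exact: measurable_fun_pair.
exact: (measurableT_comp act_measurable mswap).
Qed.

Lemma measurable_orbit_average (g : X -> \bar R) :
  measurable_fun [set: X] g -> (forall x, 0 <= g x) ->
  measurable_fun [set: X] (orbit_average pi act g).
Proof.
move=> mg g_ge0.
apply: (measurable_fun_fubini_tonelli_F (m2 := pi) _ (measurable_act_comp mg)).
by move=> p.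
Qed.

(** After exchanging the integrals, invariance of [mu] makes the inner one independent of [s], and
    [pi] has total mass 1. *)
Lemma integral_orbit_average (mu : probability X R) (g : X -> \bar R) :
  invariant_probability act mu ->
  measurable_fun [set: X] g -> (forall x, 0 <= g x) ->
  \int[mu]_x orbit_average pi act g x = \int[mu]_x g x.
Proof.
move=> mu_inv mg g_ge0; rewrite /orbit_average.
rewrite (fubini_tonelli (m1 := mu) (m2 := pi) _ (measurable_act_comp mg))//=.
transitivity (\int[pi]_s cst (\int[mu]_x g x) s); last first.
  by rewrite integral_cst_probability.
apply: eq_integral => s _ /=.
rewrite -[LHS](ge0_integral_pushforward (measurable_act s) mu measurableT mg)//.
apply: eq_measure_integral => [|ms A mA _]; first exact: measurable_act.
exact: esym (mu_inv s A mA).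
Qed.

Lemma orbit_average_addl1 (f : X -> \bar R) (x : X) :
  measurable_fun [set: X] f -> (forall x, -1 <= f x) ->
  orbit_average pi act (fun y => 1 + f y) x = 1 + orbit_average pi act f x.
Proof.
move=> mf f_ge; apply: integral_addl1 => //.
exact: measurableT_comp mf (measurable_orbit_map x).
Qed.

Lemma exact_e_variable_orbit_average (f : X -> \bar R) :
  measurable_fun [set: X] f -> (forall x, -1 <= f x) ->
  (forall x, orbit_average pi act f x <= 0) ->
  exact_e_variable (invariant_probability (R := R) act)
    (fun x => 1 + f x - orbit_average pi act f x).
Proof.
move=> mf f_ge fpi_le0; set k := orbit_average pi act f.
have mg : measurable_fun [set: X] (fun x => 1 + f x) by exact: emeasurable_funD.
have g_ge0 x : 0 <= 1 + f x by rewrite adde1_ge0.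
have gkE x : orbit_average pi act (fun y => 1 + f y) x = 1 + k x.
  exact: orbit_average_addl1.
have k1_ge0 x : 0 <= 1 + k x by rewrite -gkE; apply: integral_ge0.
(* Since [-1 <= k x <= 0], the average is finite even where [f] takes the value [+oo]; this is what
   allows [k] to be cancelled pointwise below. *)
have k_fin x : k x \is a fin_num.
  rewrite fin_real// (le_lt_trans (fpi_le0 x))// andbT.
  by rewrite (@lt_le_trans _ _ (-1))// -?adde1_ge0 ?ltNyr.
have mk1 : measurable_fun [set: X] (fun x => 1 + k x).
  by under eq_fun do rewrite -gkE; exact: measurable_orbit_average.
have mNk : measurable_fun [set: X] (fun x => - k x).
  apply: measurableT_comp => //.
  (* Tonelli gives measurability of averages of nonnegative functions only, so that of [k] is
     recovered from [1 + k], the average of [1 + f]. *)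
  rewrite (_ : k = (fun x => (1 + k x) - 1)).
    exact: emeasurable_funB.
  by apply/funext => x; rewrite addeAC subee// add0e.
have Nk_ge0 x : 0 <= - k x by rewrite oppe_ge0.
have int1 mu : invariant_probability (R := R) act mu ->
    \int[mu]_x (1 + f x - k x) = 1.
  move=> mu_inv; rewrite ge0_integralD//.
  (* The integral of [1 + f] becomes that of [1 + k]; merged with the integral of [- k], it has the
     constant integrand 1. *)
  rewrite -(integral_orbit_average mu_inv mg g_ge0).
  under [X in X + _]eq_integral do rewrite gkE.
  rewrite -ge0_integralD//.
  under eq_integral do rewrite addeK//.
  by rewrite integral_cst_probability.
split => //; split => [|x|mu /int1 ->//].
  exact: emeasurable_funD.
exact: adde_ge0.
Qed.

End OrbitAverage.

Theorem theorem5p5 (R : realType) (G : topologicalGroupType)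
    (d : measure_display) (X : measurableType d)
    (act : G -> X -> X) (pi : probability (borel G) R)
    (G_compact : compact [set: G])
    (act_left : left_action act)
    (act_measurable : measurable_action act)
    (pi_haar : left_haar pi) :
  [set h : X -> \bar R | e_variable (invariant_probability (R := R) act) h] =
  [set h : X -> \bar R |
    [/\ measurable_fun [set: X] h,
        forall x, 0 <= h x
      & exists f : X -> \bar R,
        [/\ measurable_fun [set: X] f,
            forall x, -1 <= f x,
            forall x, orbit_average pi act f x <= 0,
            e_variable (invariant_probability (R := R) act)
              (fun x => 1 + f x - orbit_average pi act f x)
          & forall x, h x <= 1 + f x - orbit_average pi act f x]]]
  /\
  (forall f : X -> \bar R,
    measurable_fun [set: X] f ->
    (forall x, -1 <= f x) ->
    (forall x, orbit_average pi act f x <= 0) ->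
    exact_e_variable (invariant_probability (R := R) act)
      (fun x => 1 + f x - orbit_average pi act f x)).
Proof.
have [pi_inv _ _] := pi_haar.
have exactP := exact_e_variable_orbit_average (pi := pi) act_measurable.
split => //; apply/seteqP; split => h /=.
  move=> eh; have [mh h_ge0 _] := eh; split => //.
  pose f x := h x - 1; exists f.
  have mf : measurable_fun [set: X] f by exact: emeasurable_funB.
  have f_ge x : -1 <= f x by rewrite leeBrDr// addeC subee.
  (* This also holds where [h x] is [+oo], because the constant subtracted is finite. *)
  have hE x : 1 + f x = h x by rewrite addeC subeK.
  have fpi_le0 x : orbit_average pi act f x <= 0.
    have := orbit_average_le1 act_left act_measurable x pi_inv eh.
    under [h]eq_fun do rewrite -hE.
    by rewrite orbit_average_addl1// addeC -leeBrDr// subee.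
  split => //; first by have [] := exactP f mf f_ge fpi_le0.
  by move=> x; rewrite hE leeDl// oppe_ge0.
(* Conversely, monotonicity of the integral passes the bound 1 from the dominating e-variable to
   [h]. *)
move=> [mh h_ge0 [f [_ _ _ [mk k_ge0 k_le1] h_le]]]; split => // mu mu_inv.
by apply: le_trans (k_le1 mu mu_inv); apply: ge0_le_integral.
Qed.
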